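(* Given $\boldsymbol r,\boldsymbol p\in[0,1]^T$, one can compute $\mathrm{ATB}(\boldsymbol r,\boldsymbol p)$ exactly in time $O(T\log T)$. Moreover, one can approximate $\mathrm{ATB}(\boldsymbol r,\boldsymbol p)$ up to arbitrary additive error $\varepsilon>0$ in time $O(T+1/\varepsilon)$.
   Context: For $\boldsymbol r=(r_1,\ldots,r_T),\boldsymbol p=(p_1,\ldots,p_T)\in[0,1]^T$, $$\mathrm{ATB}(\boldsymbol r,\boldsymbol p)=\mathbb E_{q\sim\mathrm{Unif}([0,1])}\left[\frac1{T^2}\left(\Big(\sum_{t:r_t<q}(r_t-p_t)\Big)^2+\Big(\sum_{t:r_t\ge q}(r_t-p_t)\Big)^2\right)\right].$$ Approximating up to additive error $\varepsilon$ means outputting a number $a$ with $|a-\mathrm{ATB}(\boldsymbol r,\boldsymbol p)|\le\varepsilon$. The algorithms are deterministic. Running time is counted in the usual unit-cost model: arithmetic operations and comparisons on real numbers, rounding a real number to a multiple of a given step size, and array access each cost one unit. Constants in $O(\cdot)$ are absolute. *)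

(* Defs.v *)
From mathcomp Require Import all_boot all_order all_algebra.
From mathcomp Require Import all_classical all_reals all_analysis.

Set Implicit Arguments.
Unset Strict Implicit.
Unset Printing Implicit Defensive.

Import Order.TTheory GRing.Theory Num.Theory.
Local Open Scope classical_set_scope.
Local Open Scope ring_scope.

Definition threshold_bias (R : realType) (T : nat) (r p : 'I_T -> R) (q : R) :
    R :=
  1 / T%:R ^+ 2 *
    ((\sum_(t < T | r t < q) (r t - p t)) ^+ 2 +
     (\sum_(t < T | r t >= q) (r t - p t)) ^+ 2).

(* Extended-real valued, as expectations are in the library. *)
Definition ATB (R : realType) (T : nat) (r p : 'I_T -> R) : \bar R :=
  ('E_(uniform_prob (@ltr01 R)) [threshold_bias r p])%E.

(* A unit-cost real RAM, given as an imperative language.  Registers and array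
   cells hold real numbers; registers and arrays are named by natural numbers.
   A program is a finite syntax tree whose only literals are natural numbers,
   so it can encode neither real constants nor data depending on the input. *)

Inductive binop := Oadd | Osub | Omul | Odiv | Ornd.

Inductive expr :=
  | Elit of nat
  | Ereg of nat
  | Eget of nat & expr
  | Eop of binop & expr & expr.

Inductive test :=
  | Ble of expr & expr
  | Blt of expr & expr
  | Beq of expr & expr
  | Bnot of test
  | Band of test & test.

Inductive prog :=
  | Pskip
  | Pset of nat & expr
  | Pput of nat & expr & expr  (* array, index, value *)
  | Pseq of prog & prog
  | Pif of test & prog & prog
  | Pwhile of test & prog.

Record state (R : realType) := State {
  reg : nat -> R;
  arr : nat -> nat -> R
}.

Definition set_reg (R : realType) (s : state R) (x : nat) (v : R) : state R :=
  State (fun y => if y == x then v else reg s y) (arr s).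

Definition set_arr (R : realType) (s : state R) (a i : nat) (v : R) : state R :=
  State (reg s)
    (fun b j => if (b == a) && (j == i) then v else arr s b j).

(* Rounding is downwards, to a multiple of the step d. *)
Definition round_down (R : realType) (x d : R) : R :=
  (Num.floor (x / d))%:~R * d.

(* Division by 0 yields 0, as in the library; a program can test for it. *)
Definition eval_op (R : realType) (o : binop) : R -> R -> R :=
  match o with
  | Oadd => fun x y => x + y
  | Osub => fun x y => x - y
  | Omul => fun x y => x * y
  | Odiv => fun x y => x / y
  | Ornd => fun x y => round_down x y
  end.

(* An array index is a real number n%:R; other reals are truncated to a
   natural number, which keeps the semantics total. *)
Fixpoint eval (R : realType) (s : state R) (e : expr) : R :=
  match e with
  | Elit n => n%:R
  | Ereg x => reg s x
  | Eget a e1 => arr s a (Num.truncn (eval s e1))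
  | Eop o e1 e2 => eval_op o (eval s e1) (eval s e2)
  end.

Fixpoint holds (R : realType) (s : state R) (b : test) : bool :=
  match b with
  | Ble e1 e2 => eval s e1 <= eval s e2
  | Blt e1 e2 => eval s e1 < eval s e2
  | Beq e1 e2 => eval s e1 == eval s e2
  | Bnot b1 => ~~ holds s b1
  | Band b1 b2 => holds s b1 && holds s b2
  end.

(* Every node of an expression or test costs one unit each time it is
   evaluated, including literals and register reads. *)
Fixpoint expr_cost (e : expr) : nat :=
  match e with
  | Elit _ | Ereg _ => 1
  | Eget _ e1 => (expr_cost e1).+1
  | Eop _ e1 e2 => (expr_cost e1 + expr_cost e2).+1
  end.

Fixpoint test_cost (b : test) : nat :=
  match b with
  | Ble e1 e2 | Blt e1 e2 | Beq e1 e2 => (expr_cost e1 + expr_cost e2).+1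
  | Bnot b1 => (test_cost b1).+1
  | Band b1 b2 => (test_cost b1 + test_cost b2).+1
  end.

(* [exec c s s' n]: started in s, the program c halts in s' after n units. *)
Inductive exec (R : realType) : prog -> state R -> state R -> nat -> Prop :=
  | exec_skip s : exec Pskip s s 1
  | exec_set s x e :
      exec (Pset x e) s (set_reg s x (eval s e)) (expr_cost e).+1
  | exec_put s a e1 e2 :
      exec (Pput a e1 e2) s
        (set_arr s a (Num.truncn (eval s e1)) (eval s e2))
        (expr_cost e1 + expr_cost e2).+1
  | exec_seq c1 c2 s s1 s2 n1 n2 :
      exec c1 s s1 n1 -> exec c2 s1 s2 n2 ->
      exec (Pseq c1 c2) s s2 (n1 + n2)
  | exec_if b c1 c2 s s1 n :
      exec (if holds s b then c1 else c2) s s1 n ->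
      exec (Pif b c1 c2) s s1 (test_cost b + n)
  | exec_while_stop b c s :
      ~~ holds s b -> exec (Pwhile b c) s s (test_cost b)
  | exec_while_step b c s s1 s2 n1 n2 :
      holds s b -> exec c s s1 n1 -> exec (Pwhile b c) s1 s2 n2 ->
      exec (Pwhile b c) s s2 (test_cost b + n1 + n2).

Lemma exec_det (R : realType) (c : prog) (s s1 s2 : state R) (n1 n2 : nat) :
  exec c s s1 n1 -> exec c s s2 n2 -> s1 = s2 /\ n1 = n2.
Proof.
move=> H; elim: H s2 n2 => {c s s1 n1}.
- by move=> s s2 n2 H; inversion H.
- by move=> s x e s2 n2 H; inversion H.
- by move=> s a e1 e2 s2 n2 H; inversion H.
- move=> c1 c2 s s1 s1' n1 n1' _ IH1 _ IH2 s2 n2 H.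
  inversion H as [| | |? ? ? s3 ? ? ? K1 K2| | |]; subst.
  case: (IH1 _ _ K1) => ? ?; subst.
  by case: (IH2 _ _ K2) => -> ->.
- move=> b c1 c2 s s1 n _ IH s2 n2 H.
  inversion H as [| | | |? ? ? ? ? ? K| |]; subst.
  by case: (IH _ _ K) => -> ->.
- move=> b c s nb s2 n2 H.
  inversion H as [| | | | | |? ? ? ? ? ? ? hb]; subst => //.
  by rewrite hb in nb.
- move=> b c s s1 s1' n1 n1' hb _ IH1 _ IH2 s2 n2 H.
  inversion H as [| | | | |? ? ? nb|? ? ? s3 ? ? ? ? K1 K2]; subst.
    by rewrite hb in nb.
  case: (IH1 _ _ K1) => ? ?; subst.
  by case: (IH2 _ _ K2) => -> ->.
Qed.

(* Array 0 holds r, array 1 holds p and register 0 holds T.  All remaining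
   registers and cells are arbitrary: a program must initialize, at its own
   cost, whatever memory it uses. *)
Definition loaded (R : realType) (T : nat) (r p : 'I_T -> R) (s : state R) :
    Prop :=
  [/\ reg s 0 = T%:R,
      forall t : 'I_T, arr s 0 t = r t &
      forall t : 'I_T, arr s 1 t = p t].

Definition unit_valued (R : realType) (T : nat) (r : 'I_T -> R) : Prop :=
  forall t : 'I_T, 0 <= r t <= 1.

(* Main.v *)
(* Write d_t = r_t - p_t.  Expanding the squares of the integrand turns the two
   sums into sums over pairs (s, t) of d_s d_t times the indicators of
   max(r_s, r_t) < q and q <= min(r_s, r_t), so that
     T^2 ATB(r, p) = sum over s, t of d_s d_t (1 - |r_s - r_t|).
   When the r_t are sorted, one sweep maintaining the prefix sums of d_t and
   d_t r_t evaluates the right-hand side.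

   Exact computation: pad the input with entries of weight d = 0 up to a power
   of two, run a bottom-up merge sort, and sweep.

   Approximation: replace r_t by the multiple of eps just below it.  Each
   |r_s - r_t| moves by at most eps and |d_s d_t| <= 1, so ATB moves by at most
   eps; the rounded points are bucketed into about 1 / eps cells, which are
   already in order, and the sweep runs over the buckets. *)

Require Import Defs.
From mathcomp Require Import all_boot all_order all_algebra.
From mathcomp Require Import all_classical all_reals all_analysis.
From mathcomp Require Import measurable_realfun ring lra zify.

Set Implicit Arguments.
Unset Strict Implicit.
Unset Printing Implicit Defensive.

Import Order.TTheory GRing.Theory Num.Theory.
Local Open Scope ring_scope.

(** * The average threshold bias as a quadratic form *)

Section Integral.
Local Open Scope classical_set_scope.
Context {R : realType}.
Implicit Types a b : R.

Local Notation U := (uniform_prob (@ltr01 R)).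

(** The indicator of [A] is integrated against the uniform law, whose density is 1 on [0, 1]. *)
Lemma uniform_prob_itv (A : set (measurableTypeR R)) : measurable A ->
  U A = lebesgue_measure (A `&` `[0, 1]%classic).
Proof.
move=> mA.
have := @integral_indic _ _ R U setT measurableT _ mA.
rewrite setIT => <-.
rewrite integral_uniform; last 2 first.
- exact/measurable_EFinP/measurable_indic.
- by move=> x; rewrite lee_fin.
rewrite subr0 invr1 mul1e integral_indic//.
Qed.

Lemma uniform_prob_gt a : 0 <= a <= 1 -> U [set q | a < q] = (1 - a)%:E.
Proof.
move=> /andP[a0 a1].
have -> : [set q | a < q] = `]a, +oo[%classic by rewrite set_itvE.
rewrite uniform_prob_itv//.
have -> : `]a, +oo[%classic `&` `[0, 1]%classic = `]a, 1]%classic.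
  apply/seteqP; split=> x /=; rewrite !in_itv/= ?andbT.
    by case=> -> /andP[_ ->].
  by move=> /andP[ax x1]; rewrite ax x1 (le_trans a0 (ltW ax)).
rewrite lebesgue_measure_itv/= lte_fin -EFinB; case: ifPn => //.
rewrite -leNgt => a_ge1.
have -> : a = 1 by apply/le_anti/andP; split.
by rewrite subrr.
Qed.

Lemma uniform_prob_le a : 0 <= a <= 1 -> U [set q | q <= a] = a%:E.
Proof.
move=> /andP[a0 a1].
have -> : [set q | q <= a] = `]-oo, a]%classic by rewrite set_itvE.
rewrite uniform_prob_itv//.
have -> : `]-oo, a]%classic `&` `[0, 1]%classic = `[0, a]%classic.
  apply/seteqP; split=> x /=; rewrite !in_itv/=.
    by case=> -> /andP[->].
  by move=> /andP[x0 xa]; rewrite xa x0 (le_trans xa a1).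
rewrite lebesgue_measure_itv/= lte_fin -EFinB subr0; case: ifPn => //.
rewrite -leNgt => a_le0.
by have -> : a = 0 by apply/le_anti/andP; split.
Qed.

Lemma sqr_sum_cond (T : nat) (P : pred 'I_T) (d : 'I_T -> R) :
  (\sum_(t < T | P t) d t) ^+ 2 =
  \sum_s \sum_t d s * d t * (P s && P t)%:R.
Proof.
rewrite expr2 big_distrlr/= [LHS]big_mkcond; apply: eq_bigr => s _.
case: (P s) => /=; last by rewrite big1// => t _; rewrite mulr0.
rewrite big_mkcond; apply: eq_bigr => t _.
by case: (P t); rewrite ?mulr1 ?mulr0.
Qed.

(** All dependence on [q] moves into two indicators whose coefficients are free of [q], the form to
    which linearity of the integral applies. *)
Lemma threshold_biasE (T : nat) (r p : 'I_T -> R) (q : R) :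
  threshold_bias r p q = \sum_s \sum_t
    ((r s - p s) * (r t - p t) / T%:R ^+ 2) *
    (\1_[set q | Num.max (r s) (r t) < q] q +
     \1_[set q | q <= Num.min (r s) (r t)] q).
Proof.
rewrite /threshold_bias !sqr_sum_cond -big_split/= mulr_sumr.
apply: eq_bigr => s _; rewrite -big_split/= mulr_sumr; apply: eq_bigr => t _.
have indicb (b : pred R) : \1_[set x | b x] q = (b q)%:R :> R.
  by rewrite indicE; congr (nat_of_bool _)%:R; apply/idP/idP; rewrite inE.
rewrite !indicb gt_max le_min div1r; ring.
Qed.

(** Maxima and minima of values in [0, 1] stay in [0, 1], so the two indicators have probabilities 1
    - max and min; and 1 - max + min = 1 - |r_s - r_t|. *)
Lemma ATBE (T : nat) (r p : 'I_T -> R) : unit_valued r ->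
  ATB r p = (\sum_s \sum_t (r s - p s) * (r t - p t) * (1 - `|r s - r t|)
             / T%:R ^+ 2)%:E.
Proof.
move=> r01; rewrite /ATB unlock.
have mgt a : measurable ([set q | a < q] : set (measurableTypeR R)).
  by have -> : [set q | a < q] = `]a, +oo[%classic by rewrite set_itvE.
have mle a : measurable ([set q | q <= a] : set (measurableTypeR R)).
  by have -> : [set q | q <= a] = `]-oo, a]%classic by rewrite set_itvE.
have iI s t : (U.-integrable setT (fun q =>
    (\1_[set q | Num.max (r s) (r t) < q] q +
     \1_[set q | q <= Num.min (r s) (r t)] q)%:E))%E.
  under eq_fun do rewrite EFinD.
  apply: integrableD => //.
    by refine (integrable_indic _ (mgt _)).
  by refine (integrable_indic _ (mle _)).
under eq_integral.
  move=> q _; rewrite threshold_biasE -sumEFin.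
  under eq_bigr do rewrite -sumEFin.
  over.
rewrite integral_sum//; last first.
  move=> s; apply: integrable_sum => // t _.
  by under eq_fun do rewrite EFinM; exact: integrableZl.
rewrite -sumEFin; apply: eq_bigr => s _.
rewrite integral_sum//; last first.
  by move=> t; under eq_fun do rewrite EFinM; exact: integrableZl.
rewrite -sumEFin; apply: eq_bigr => t _.
under eq_integral do rewrite EFinM.
rewrite integralZl//.
under eq_integral do rewrite EFinD.
rewrite integralD//=;
  [|refine (integrable_indic _ (mgt _))|refine (integrable_indic _ (mle _))].
rewrite !integral_indic//= !setIT.
have /andP[s0 s1] := r01 s; have /andP[t0 t1] := r01 t.
rewrite [X in (_ * (X + _))%E](@uniform_prob_gt (Num.max (r s) (r t)));
  last first.
  by rewrite le_max ge_max s0 s1 t1.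
rewrite [X in (_ * (_ + X))%E](@uniform_prob_le (Num.min (r s) (r t)));
  last first.
  by rewrite le_min ge_min s0 t0 s1.
rewrite -EFinD -EFinM; congr EFin.
rewrite mulrAC; congr (_ * _ / _).
by have [h|h] := leP (r s) (r t);
  [rewrite ler0_norm ?subr_le0// | rewrite gtr0_norm ?subr_gt0//]; ring.
Qed.

End Integral.

(** * Total correctness with time bounds *)

(* [eval] alone now denotes a map of mathcomp-analysis. *)
Local Notation eval := Defs.eval.

(** Syntactic bound on the registers that a program can write; together with [modified_arrs] it
    yields a frame rule. *)
Fixpoint modified_regs (c : prog) : seq nat :=
  match c with
  | Pskip | Pput _ _ _ => [::]
  | Pset x _ => [:: x]
  | Pseq c1 c2 | Pif _ c1 c2 => modified_regs c1 ++ modified_regs c2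
  | Pwhile _ c1 => modified_regs c1
  end.

Fixpoint modified_arrs (c : prog) : seq nat :=
  match c with
  | Pskip | Pset _ _ => [::]
  | Pput a _ _ => [:: a]
  | Pseq c1 c2 | Pif _ c1 c2 => modified_arrs c1 ++ modified_arrs c2
  | Pwhile _ c1 => modified_arrs c1
  end.

Fixpoint loop_free (c : prog) : bool :=
  match c with
  | Pskip | Pset _ _ | Pput _ _ _ => true
  | Pseq c1 c2 | Pif _ c1 c2 => loop_free c1 && loop_free c2
  | Pwhile _ _ => false
  end.

(* Meaningful only for loop-free programs, like [run] below. *)
Fixpoint max_cost (c : prog) : nat :=
  match c with
  | Pskip | Pwhile _ _ => 1
  | Pset _ e => (expr_cost e).+1
  | Pput _ e1 e2 => (expr_cost e1 + expr_cost e2).+1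
  | Pseq c1 c2 => max_cost c1 + max_cost c2
  | Pif b c1 c2 => test_cost b + maxn (max_cost c1) (max_cost c2)
  end.

Section Runs.
Context {R : realType}.
Implicit Types (s : state R) (Q : state R -> Prop).

Definition unchanged (c : prog) s s' : Prop :=
  (forall x, x \notin modified_regs c -> reg s' x = reg s x) /\
  (forall a, a \notin modified_arrs c -> arr s' a = arr s a).

(** Only assignments write, and each target is listed. Loop invariants may therefore leave out
    memory that the body never assigns. *)
Lemma exec_unchanged c s s' n : exec c s s' n -> unchanged c s s'.
Proof.
elim=> {c s s' n} //=.
- by move=> s x e; split=> //= y; rewrite inE => /negbTE ->.
- move=> s a e1 e2; split=> //= b; rewrite inE => /negbTE /= ->.
  by apply/funext.
- move=> c1 c2 s s1 s2 n1 n2 _ [IHr1 IHa1] _ [IHr2 IHa2].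
  split=> x /=; rewrite mem_cat negb_or => /andP[x1 x2].
    by rewrite IHr2// IHr1.
  by rewrite IHa2// IHa1.
- move=> b c1 c2 s s1 n _ [IHr IHa].
  split=> x /=; rewrite mem_cat negb_or => /andP[x1 x2].
    by rewrite IHr//; case: ifP.
  by rewrite IHa//; case: ifP.
- move=> b c s s1 s2 n1 n2 _ _ [IHr1 IHa1] _ [IHr2 IHa2].
  split=> x /= xc.
    by rewrite IHr2// IHr1.
  by rewrite IHa2// IHa1.
Qed.

Lemma unchanged_trans c s1 s2 s3 :
  unchanged c s1 s2 -> unchanged c s2 s3 -> unchanged c s1 s3.
Proof.
move=> [r12 a12] [r23 a23].
by split=> x xc; [rewrite r23// r12 | rewrite a23// a12].
Qed.

(** Total correctness with a time bound. By [exec_det] the witnesses are the only outcome of [c]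
    from [s]. *)
Definition runs (c : prog) s (n : nat) Q : Prop :=
  exists s' m, [/\ exec c s s' m, (m <= n)%N & Q s'].

Lemma runs_weaken c s n n' Q Q' : runs c s n Q -> (n <= n')%N ->
  (forall s', Q s' -> unchanged c s s' -> Q' s') -> runs c s n' Q'.
Proof.
move=> [s' [m [cs' mn Qs']]] nn' QQ'; exists s', m.
by split=> //; [exact: leq_trans nn' | exact: QQ' (exec_unchanged cs')].
Qed.

Fixpoint run (c : prog) s : state R :=
  match c with
  | Pskip | Pwhile _ _ => s
  | Pset x e => set_reg s x (eval s e)
  | Pput a e1 e2 => set_arr s a (Num.truncn (eval s e1)) (eval s e2)
  | Pseq c1 c2 => run c2 (run c1 s)
  | Pif b c1 c2 => if holds s b then run c1 s else run c2 s
  end.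

Lemma exec_loop_free c s : loop_free c ->
  exists2 n, exec c s (run c s) n & (n <= max_cost c)%N.
Proof.
elim: c s => [|x e|a e1 e2|c1 IH1 c2 IH2|b c1 IH1 c2 IH2|//] s /=.
- by exists 1%N; first exact: exec_skip.
- by exists (expr_cost e).+1; first exact: exec_set.
- by exists (expr_cost e1 + expr_cost e2).+1; first exact: exec_put.
- move=> /andP[/IH1 f1 /IH2 f2].
  have [n1 e1 l1] := f1 s; have [n2 e2 l2] := f2 (run c1 s).
  by exists (n1 + n2)%N; [exact: exec_seq e1 e2 | exact: leq_add].
- move=> /andP[/IH1 f1 /IH2 f2].
  have [n1 e1 l1] := f1 s; have [n2 e2 l2] := f2 s.
  have [hb|hb] := boolP (holds s b).
    exists (test_cost b + n1)%N; first by apply: exec_if; rewrite hb.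
    by rewrite leq_add2l leq_max l1.
  exists (test_cost b + n2)%N; first by apply: exec_if; rewrite (negbTE hb).
  by rewrite leq_add2l leq_max l2 orbT.
Qed.

(** Straight-line code is run symbolically: its final state and worst-case cost are obtained by
    computation. *)
Lemma runs_loop_free c s n Q :
  loop_free c -> (max_cost c <= n)%N -> Q (run c s) -> runs c s n Q.
Proof.
move=> /(exec_loop_free s)[m cm mc] cn Qs.
by exists (run c s), m; split=> //; exact: leq_trans cn.
Qed.

Lemma runs_seq c1 c2 s n1 n2 n Q1 Q :
  runs c1 s n1 Q1 ->
  (forall s1, Q1 s1 -> unchanged c1 s s1 -> runs c2 s1 n2 Q) ->
  (n1 + n2 <= n)%N -> runs (Pseq c1 c2) s n Q.
Proof.
move=> [s1 [m1 [e1 l1 q1]]] /(_ _ q1 (exec_unchanged e1)).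
move=> [s2 [m2 [e2 l2 q2]]] ln; exists s2, (m1 + m2)%N; split=> //.
  exact: exec_seq e1 e2.
by apply: leq_trans ln; exact: leq_add.
Qed.

(** [I k] is the invariant after [k] iterations and [K] their exact number. The bound includes the
    final failing test, and the frame condition always refers back to the state [s] before the
    loop. *)
Lemma runs_while b c s n K (I : nat -> state R -> Prop) :
  I 0%N s ->
  (forall k s', (k < K)%N -> I k s' -> unchanged c s s' ->
     holds s' b /\ runs c s' n (I k.+1)) ->
  (forall s', I K s' -> unchanged c s s' -> ~~ holds s' b) ->
  runs (Pwhile b c) s (K * (test_cost b + n) + test_cost b) (I K).
Proof.
move=> I0 IS IK.
(* Induction on the number [j] of iterations still to come. *)
suff H j k s' : (k + j = K)%N -> I k s' -> unchanged c s s' ->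
    runs (Pwhile b c) s' (j * (test_cost b + n) + test_cost b) (I K).
  exact: H I0 _.
elim: j k s' => [|j IH] k s' kj Ik us'.
  move: Ik; have -> : k = K by rewrite -kj addn0.
  move=> Ik; exists s', (test_cost b); split=> //.
  exact: exec_while_stop (IK _ Ik us').
have kK : (k < K)%N by rewrite -kj; lia.
have [hb [s1 [m1 [e1 l1 I1]]]] := IS _ _ kK Ik us'.
have [||s2 [m2 [e2 l2 I2]]] := IH k.+1 s1 _ I1.
- by rewrite -kj; lia.
- exact: unchanged_trans us' (exec_unchanged e1).
exists s2, (test_cost b + m1 + m2)%N; split=> //.
  exact: exec_while_step hb e1 e2.
lia.
Qed.

End Runs.

(* Concrete syntax and register names *)
Declare Scope prog_scope.
Delimit Scope prog_scope with P.
Bind Scope prog_scope with expr prog test.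
Local Notation "$ x" := (Ereg x)
  (at level 2, x at level 1, format "$ x") : prog_scope.
Local Notation "x + y" := (Eop Oadd x y) : prog_scope.
Local Notation "x - y" := (Eop Osub x y) : prog_scope.
Local Notation "x * y" := (Eop Omul x y) : prog_scope.
Local Notation "x / y" := (Eop Odiv x y) : prog_scope.
Local Notation "x ::= e" := (Pset x e%P) (at level 55) : prog_scope.
Local Notation "x <= y" := (Ble x%P y%P) : prog_scope.
Local Notation "x < y" := (Blt x%P y%P) : prog_scope.
Local Notation "c1 ;; c2" := (Pseq c1%P c2%P)
  (at level 60, right associativity) : prog_scope.

Local Notation rT := 0%N.
Local Notation rE := 1%N.
Local Notation rN := 2%N.
Local Notation rW := 3%N.
Local Notation rLo := 4%N.
Local Notation rI := 5%N.
Local Notation rJ := 6%N.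
Local Notation rK := 7%N.
Local Notation rMid := 8%N.
Local Notation rHi := 9%N.
Local Notation rP := 10%N.
Local Notation rQ := 11%N.
Local Notation rAcc := 12%N.

(** * Sweeping a sorted array *)

(** Array 2 holds positions x, array 3 weights d. [rP] and [rQ] are the prefix sums of d and d x,
    and [rAcc] collects d_i d_j (x_i - x_j) over j < i. *)
Definition sweep_step : prog := (
  rAcc ::= $rAcc + Eget 3 $rK * (Eget 2 $rK * $rP - $rQ) ;;
  rP ::= $rP + Eget 3 $rK ;;
  rQ ::= $rQ + Eget 3 $rK * Eget 2 $rK ;;
  rK ::= $rK + Elit 1)%P.

(** At the end the square of [rP] is the sum of d_i d_j over all ordered pairs, while [rAcc] counts
    each unordered pair once, hence the factor 2. The result overwrites T in register 0. *)
Definition sweep : prog := (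
  (rK ::= Elit 0 ;; rP ::= Elit 0 ;; rQ ::= Elit 0 ;; rAcc ::= Elit 0) ;;
  Pwhile ($rK < $rN) sweep_step ;;
  rT ::= ($rP * $rP - Elit 2 * $rAcc) / ($rT * $rT))%P.

(* Keeps the literals produced by [eval] in the form [n%:R]. *)
Local Arguments Algebra.natmul : simpl never.

Section Sweep.
Context {R : realType}.
Implicit Types (s : state R) (x d : nat -> R).

(** The quadratic form of T^2 ATB with positions and weights decoupled, so that it also applies to
    padded, sorted or bucketed data. *)
Definition similarity (n : nat) x d : R :=
  \sum_(i < n) \sum_(j < n) d i * d j * (1 - `|x i - x j|).

(** As x_n is the largest position, |x_n - x_j| opens to x_n - x_j. By symmetry the new row and
    column contribute equally, and the diagonal adds d_n^2. *)
Lemma similarityS n x d : (forall i, (i < n)%N -> x i <= x n) ->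
  similarity n.+1 x d = similarity n x d +
    2 * (d n * \sum_(j < n) d j - d n * (x n * \sum_(j < n) d j -
                                    \sum_(j < n) d j * x j)) + d n ^+ 2.
Proof.
move=> xn; rewrite /similarity big_ord_recr/= big_ord_recr/= subrr normr0.
under eq_bigr do rewrite big_ord_recr/=.
rewrite big_split/=.
have E : \sum_(j < n) d n * d j * (1 - `|x n - x j|) =
    d n * \sum_(j < n) d j - d n * (x n * \sum_(j < n) d j -
                                    \sum_(j < n) d j * x j).
  rewrite (mulr_sumr _ _ _ (x n)) -sumrB !mulr_sumr -sumrB.
  apply: eq_bigr => j _; rewrite ger0_norm ?subr_ge0 ?xn//; ring.
have E' : \sum_(i < n) d i * d n * (1 - `|x i - x n|) =
    \sum_(j < n) d n * d j * (1 - `|x n - x j|).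
  by apply: eq_bigr => i _; rewrite distrC (mulrC (d i)).
rewrite E' E; ring.
Qed.

Lemma runs_sweep s (N T : nat) :
  reg s rT = T%:R -> reg s rN = N%:R ->
  (forall i j, (i <= j < N)%N -> arr s 2 i <= arr s 2 j) ->
  runs sweep s (50 * N + 50)%N (fun s' =>
    reg s' 0 = similarity N (arr s 2) (arr s 3) / T%:R ^+ 2).
Proof.
move=> sT sN mono.
apply: (@runs_seq _ _ _ _ 8 (50 * N + 42) _ (fun s1 =>
  [/\ reg s1 rK = 0, reg s1 rP = 0, reg s1 rQ = 0 & reg s1 rAcc = 0])); last lia.
  exact: runs_loop_free.
move=> s1 [s1K s1P s1Q s1A] [u1r u1a].
pose I k s' := [/\ reg s' rK = k%:R,
  reg s' rP = \sum_(i < k) arr s 3 i,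
  reg s' rQ = \sum_(i < k) arr s 3 i * arr s 2 i &
  reg s' rP ^+ 2 - 2 * reg s' rAcc = similarity k (arr s 2) (arr s 3)].
(* The test costs 3, the body at most 30, and the final assignment 12. *)
apply: (@runs_seq _ _ _ _ (N * (3 + 30) + 3) 12 _ (I N)); last lia.
  apply: runs_while.
  - by rewrite /I /similarity !big_ord0 s1K s1P s1Q s1A; split=> //; ring.
  - move=> k s2 kN [s2K s2P s2Q s2A] [u2r u2a]; split.
      by rewrite /= s2K u2r// u1r// sN ltr_nat.
    apply: runs_loop_free => //.
    rewrite /I /= s2K natrK u2a// u2a// u1a// u1a//.
    rewrite !big_ord_recr/= similarityS; last first.
      by move=> i ik; apply: mono; rewrite ltnW.
    rewrite s2P s2Q natr1; split=> //.
    by rewrite -s2A s2P; ring.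
  - by move=> s2 [s2K _ _ _] [u2r _]; rewrite /= s2K u2r// u1r// sN ltxx.
move=> s2 [_ _ _ s2A] [u2r _].
apply: runs_loop_free => //=.
by rewrite (u2r rT)// u1r// sT -s2A !expr2.
Qed.

End Sweep.

(** * Merge sort *)

(** Array segments as sequences, so that the theory of [merge], [sorted] and [perm_eq] applies to
    them. *)
Definition slice (X : Type) (f : nat -> X) (i j : nat) : seq X :=
  [seq f k | k <- index_iota i j].

Section Slice.
Context {X : Type}.
Implicit Types f g : nat -> X.

Lemma size_slice f i j : size (slice f i j) = (j - i)%N.
Proof. by rewrite size_map size_iota. Qed.

Lemma slice_nil f i : slice f i i = [::].
Proof. by rewrite /slice /index_iota subnn. Qed.

Lemma slice_cons f i j : (i < j)%N -> slice f i j = f i :: slice f i.+1 j.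
Proof. by move=> ij; rewrite /slice /index_iota -subnSK. Qed.

Lemma slice_cat f i j k : (i <= j <= k)%N ->
  slice f i k = slice f i j ++ slice f j k.
Proof.
move=> /andP[ij jk]; rewrite /slice /index_iota -map_cat.
have -> : (k - i = (j - i) + (k - j))%N by lia.
by rewrite iotaD subnKC.
Qed.

Lemma slice_rcons f i j : (i <= j)%N ->
  slice f i j.+1 = rcons (slice f i j) (f j).
Proof.
move=> ij; rewrite (@slice_cat _ _ j) ?ij ?leqnSn// (@slice_cons _ j)//.
by rewrite slice_nil cats1.
Qed.

Lemma nth_slice x0 f i j k : (k < j - i)%N ->
  nth x0 (slice f i j) k = f (i + k)%N.
Proof.
move=> kj; rewrite (nth_map 0%N) ?size_iota// nth_iota//.
Qed.

Lemma eq_slice f g i j : (forall k, (i <= k < j)%N -> f k = g k) ->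
  slice f i j = slice g i j.
Proof.
move=> fg; apply: (@eq_from_nth _ (f 0%N)); rewrite !size_slice// => k kj.
by rewrite !nth_slice// fg//; lia.
Qed.

End Slice.

Section MergeSlice.
Context {X : Type} (leX : rel X) (f : nat -> X).

(** One step of the imperative merge: the left head goes out when the right run is exhausted or its
    head does not precede. *)
Lemma merge_slicel i m j h : (i < m)%N -> (j <= h)%N ->
  ((j < h)%N -> leX (f i) (f j)) ->
  merge leX (slice f i m) (slice f j h) =
  f i :: merge leX (slice f i.+1 m) (slice f j h).
Proof.
move=> im; rewrite slice_cons// leq_eqVlt => /predU1P[-> _|jh /(_ jh) ij].
  by rewrite slice_nil /=; case: (slice f i.+1 m).
by rewrite (slice_cons _ jh) /= ij.
Qed.

Lemma merge_slicer i m j h : (i <= m)%N -> (j < h)%N ->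
  ((i < m)%N -> ~~ leX (f i) (f j)) ->
  merge leX (slice f i m) (slice f j h) =
  f j :: merge leX (slice f i m) (slice f j.+1 h).
Proof.
move=> im jh; rewrite (slice_cons _ jh).
move: im; rewrite leq_eqVlt => /predU1P[-> _|im /(_ im)/negbTE ij].
  by rewrite slice_nil.
by rewrite (slice_cons _ im) /= ij.
Qed.

End MergeSlice.

Lemma big_slice (V : nmodType) (X : Type) (f : nat -> X) (F : X -> V) n :
  \sum_(a <- slice f 0 n) F a = \sum_(i < n) F (f i).
Proof. by rewrite big_map big_mkord. Qed.

(** Arrays 4 and 5 are scratch space; weights travel with their keys. Ties go to the left run, as in
    [merge] for a non-strict order. *)
Definition merge_loop : prog := (
  Pwhile ($rK < $rHi) (
    Pif (Band ($rI < $rMid)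
              (Bnot (Band ($rJ < $rHi) (Eget 2 $rJ < Eget 2 $rI))))
      (Pput 4 $rK (Eget 2 $rI) ;; Pput 5 $rK (Eget 3 $rI) ;;
       rI ::= $rI + Elit 1)
      (Pput 4 $rK (Eget 2 $rJ) ;; Pput 5 $rK (Eget 3 $rJ) ;;
       rJ ::= $rJ + Elit 1) ;;
    rK ::= $rK + Elit 1))%P.

Definition copy_loop : prog := (
  Pwhile ($rK < $rHi) (
    Pput 2 $rK (Eget 4 $rK) ;; Pput 3 $rK (Eget 5 $rK) ;;
    rK ::= $rK + Elit 1))%P.

Definition merge_block : prog := (
  (rMid ::= $rLo + $rW ;; rHi ::= $rMid + $rW ;;
   rI ::= $rLo ;; rJ ::= $rMid ;; rK ::= $rLo) ;;
  merge_loop ;;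
  rK ::= $rLo ;;
  copy_loop ;;
  rLo ::= $rHi)%P.

Definition merge_pass : prog := (
  rLo ::= Elit 0 ;;
  Pwhile ($rLo < $rN) merge_block)%P.

Definition merge_sort : prog := (
  rW ::= Elit 1 ;;
  Pwhile ($rW < $rN) (merge_pass ;; rW ::= $rW + $rW))%P.

(** * Correctness and cost of bottom-up merge sort *)

Section MergeSort.
Context {R : realType}.
Implicit Types (s : state R).

(** Two consecutive arrays viewed as one array of records (key, weight). *)
Definition cell s (a k : nat) : R * R := (arr s a k, arr s a.+1 k).

Definition key_le : rel (R * R) := fun a b => a.1 <= b.1.

Lemma key_le_trans : transitive key_le.
Proof. by move=> b a c; exact: le_trans. Qed.

Lemma key_le_total : total key_le.
Proof. by move=> a b; exact: le_total. Qed.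

Lemma runs_merge_loop s (lo mid hi : nat) : (lo <= mid <= hi)%N ->
  reg s rI = lo%:R -> reg s rJ = mid%:R -> reg s rK = lo%:R ->
  reg s rMid = mid%:R -> reg s rHi = hi%:R ->
  runs merge_loop s (50 * (hi - lo) + 3)%N (fun s' =>
    slice (cell s' 4) lo hi =
    merge key_le (slice (cell s 2) lo mid) (slice (cell s 2) mid hi)).
Proof.
move=> /andP[lm mh] sI sJ sK sM sH.
(* The output so far, followed by the merge of what is left of both runs, is always the full merge;
   i + j = n + lo + mid says that [n] elements are consumed. *)
pose I n s' := exists i j, [/\ (lo <= i <= mid)%N, (mid <= j <= hi)%N,
  (i + j = n + lo + mid)%N &
  [/\ reg s' rI = i%:R, reg s' rJ = j%:R, reg s' rK = (lo + n)%:R &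
  slice (cell s' 4) lo (lo + n) ++
    merge key_le (slice (cell s 2) i mid) (slice (cell s 2) j hi) =
  merge key_le (slice (cell s 2) lo mid) (slice (cell s 2) mid hi)]].
apply: (@runs_weaken _ _ _ _ _ (I (hi - lo)%N)).
- apply: (@runs_while _ _ _ _ 45).
  + exists lo, mid; split; [lia..|split=> //].
      by rewrite addn0.
    by rewrite addn0 slice_nil.
  + move=> k s1 kn [i [j [lim mjh ij [s1I s1J s1K s1S]]]] [ur ua].
    have [s1M s1H] : reg s1 rMid = mid%:R /\ reg s1 rHi = hi%:R by rewrite !ur.
    have a2 : arr s1 2 = arr s 2 by rewrite ua.
    have a3 : arr s1 3 = arr s 3 by rewrite ua.
    split; first by rewrite /= s1K s1H ltr_nat; lia.
    apply: runs_loop_free => //=.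
    rewrite s1I s1J s1K s1M s1H !natrK !ltr_nat a2.
    case: ifP => cond.
      have {cond}[im cond] : (i < mid)%N /\
          ((j < hi)%N -> key_le (cell s 2 i) (cell s 2 j)).
        move/andP: cond => [im]; rewrite negb_and -leNgt => cond.
        by split=> // jh; move: cond; rewrite jh.
      exists i.+1, j; split; [lia..|].
      rewrite /= ?s1I ?s1J ?s1K !natr1 ?natrK addnS; split=> //.
      rewrite -s1S (@merge_slicel _ _ _ i)//; last lia.
      rewrite -cat_rcons slice_rcons; last lia.
      congr (rcons _ _ ++ _).
        apply: eq_slice => l /andP[_ ln]; rewrite /cell /=.
        by rewrite (ltn_eqF ln).
      by rewrite /cell /= eqxx ?s1I ?a2 ?a3 ?natrK.
    have {cond}[jh cond] : (j < hi)%N /\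
        ((i < mid)%N -> ~~ key_le (cell s 2 i) (cell s 2 j)).
      split=> [|im]; last first.
        by move: cond; rewrite im /= -ltNge => /negbT; rewrite negbK => /andP[].
      (* If the left run is exhausted, the count i + j = k + lo + mid with k < hi - lo still leaves
         an element on the right. *)
      move: cond; case: (ltnP i mid) => im /=; last by move=> _; lia.
      by move=> /negbT; rewrite negbK => /andP[].
    exists i, j.+1; split; [lia..|].
    rewrite /= ?s1I ?s1J ?s1K !natr1 ?natrK addnS; split=> //.
    rewrite -s1S (@merge_slicer _ _ _ _ _ j)//; last lia.
    rewrite -cat_rcons slice_rcons; last lia.
    congr (rcons _ _ ++ _).
      apply: eq_slice => l /andP[_ ln]; rewrite /cell /=.
      by rewrite (ltn_eqF ln).
    by rewrite /cell /= eqxx ?s1J ?a2 ?a3 ?natrK.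
  + move=> s1 [i [j [_ _ _ [_ _ s1K _]]]] [ur _].
    by rewrite /= s1K ur// sH ltr_nat; lia.
- by rewrite /=; lia.
- move=> s1 [i [j [lim mjh ij [_ _ _ <-]]]] _.
  (* After hi - lo elements i + j = mid + hi, so both indices have reached their bounds. *)
  have [-> ->] : i = mid /\ j = hi by lia.
  by rewrite !slice_nil /= cats0; congr slice; lia.
Qed.

Lemma runs_copy_loop s (lo hi : nat) : (lo <= hi)%N ->
  reg s rK = lo%:R -> reg s rHi = hi%:R ->
  runs copy_loop s (30 * (hi - lo) + 3)%N (fun s' => forall k,
    cell s' 2 k = if (lo <= k < hi)%N then cell s 4 k else cell s 2 k).
Proof.
move=> lh sK sH.
pose I n s' := reg s' rK = (lo + n)%:R /\ forall k,
  cell s' 2 k = if (lo <= k < lo + n)%N then cell s 4 k else cell s 2 k.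
apply: (@runs_weaken _ _ _ _ _ (I (hi - lo)%N)).
- apply: (@runs_while _ _ _ _ 20).
  + by rewrite /I addn0; split=> // k; case: ifP => //; lia.
  + move=> n s1 nh [s1K s1C] [ur ua]; split.
      by rewrite /= s1K ur// sH ltr_nat; lia.
    apply: runs_loop_free => //; split; first by rewrite /= s1K natr1 addnS.
    move=> k; have := s1C k; rewrite /cell /= s1K natrK (ua 4)// (ua 5)//.
    rewrite addnS; have [->|kn] := eqVneq k (lo + n)%N.
      by rewrite leq_addr ltnS leqnn.
    by have -> : (k < (lo + n).+1 = (k < lo + n))%N by lia.
  + by move=> s1 [s1K _] [ur _]; rewrite /= s1K ur// sH ltr_nat; lia.
- by rewrite /=; lia.
- by move=> s1 [_ s1C] _ k; rewrite s1C subnKC.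
Qed.

(** The block has 2w elements, each merged at cost at most 50 and copied back at cost at most 30,
    whence the term 160 w. *)
Lemma runs_merge_block s (lo w : nat) :
  reg s rLo = lo%:R -> reg s rW = w%:R ->
  runs merge_block s (160 * w + 50)%N (fun s' =>
    [/\ reg s' rLo = (lo + w + w)%:R,
        slice (cell s' 2) lo (lo + w + w) =
        merge key_le (slice (cell s 2) lo (lo + w))
                     (slice (cell s 2) (lo + w) (lo + w + w)) &
        forall k, ~~ (lo <= k < lo + w + w)%N -> cell s' 2 k = cell s 2 k]).
Proof.
move=> sL sW.
apply: (@runs_seq _ _ _ _ 20 (160 * w + 30) _ (fun s1 =>
  [/\ reg s1 rMid = (lo + w)%:R, reg s1 rHi = (lo + w + w)%:R &
  [/\ reg s1 rI = lo%:R, reg s1 rJ = (lo + w)%:R & reg s1 rK = lo%:R]])).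
- by apply: runs_loop_free => //=; rewrite sL sW !natrD.
- move=> s1 [s1M s1H [s1I s1J s1K]] [u1r u1a].
  apply: (@runs_seq _ _ _ _ (100 * w + 3) (60 * w + 20) _ (fun s2 =>
    slice (cell s2 4) lo (lo + w + w) =
    merge key_le (slice (cell s 2) lo (lo + w))
                 (slice (cell s 2) (lo + w) (lo + w + w)))).
  + have E2 : cell s1 2 = cell s 2 by rewrite /cell !u1a.
    rewrite -E2.
    by apply: runs_weaken (runs_merge_loop _ s1I s1J s1K s1M s1H) _ _ => //; lia.
  + move=> s2 s2S [u2r u2a].
    apply: (@runs_seq _ _ _ _ 2 (60 * w + 10) _ (fun s3 => reg s3 rK = lo%:R)).
    * by apply: runs_loop_free => //=; rewrite u2r// u1r.
    * move=> s3 s3K [u3r u3a].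
      have s3H : reg s3 rHi = (lo + w + w)%:R by rewrite u3r// u2r.
      have E2 : cell s3 2 = cell s 2.
        by rewrite /cell !(u3a 2, u2a 2, u1a 2, u3a 3, u2a 3, u1a 3).
      have E4 : cell s3 4 = cell s2 4 by rewrite /cell !(u3a 4, u3a 5).
      apply: (@runs_seq _ _ _ _ (60 * w + 3) 5 _ (fun s4 => forall k,
        cell s4 2 k = if (lo <= k < lo + w + w)%N then cell s2 4 k
                      else cell s 2 k)).
      - rewrite -E2 -E4.
        by apply: runs_weaken (runs_copy_loop _ s3K s3H) _ _ => //; lia.
      - move=> s4 s4C [u4r u4a]; apply: runs_loop_free => //=.
        split=> [| |k /negbTE kn]; first by rewrite u4r.
          by rewrite -s2S; apply: eq_slice => k lk; have := s4C k; rewrite lk.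
        by have := s4C k; rewrite kn.
      - lia.
    * lia.
  + lia.
- lia.
Qed.

(** Only blocks lying wholly below [n] are constrained, so [n] can also mark the progress of a
    pass. *)
Definition blocks_sorted (f : nat -> R * R) (w n : nat) : Prop :=
  forall b, (b.+1 * w <= n)%N -> sorted key_le (slice f (b * w) (b.+1 * w)).

Lemma runs_merge_pass s (w c : nat) : (0 < w)%N ->
  let n := (c * (w + w))%N in
  reg s rN = n%:R -> reg s rW = w%:R -> blocks_sorted (cell s 2) w n ->
  runs merge_pass s (250 * n + 10)%N (fun s' =>
    perm_eq (slice (cell s' 2) 0 n) (slice (cell s 2) 0 n) /\
    blocks_sorted (cell s' 2) (w + w) n).
Proof.
move=> w_gt0 n sN sW s_sorted.
apply: (@runs_seq _ _ _ _ 2 (250 * n + 8) _ (fun s1 => reg s1 rLo = 0)).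
- exact: runs_loop_free.
- move=> s1 s1L [u1r u1a].
  have E1 : cell s1 2 = cell s 2 by rewrite /cell !u1a.
  (* After [b] blocks the processed prefix is sorted in double blocks, and the rest is untouched, so
     its blocks of width w remain sorted. *)
  pose I b s' := [/\ reg s' rLo = (b * (w + w))%:R,
    perm_eq (slice (cell s' 2) 0 n) (slice (cell s 2) 0 n),
    blocks_sorted (cell s' 2) (w + w) (b * (w + w)) &
    forall k, (b * (w + w) <= k)%N -> cell s' 2 k = cell s 2 k].
  apply: (@runs_weaken _ _ _ _ _ (I c)).
  + apply: (@runs_while _ _ _ _ (160 * w + 50)).
    * rewrite /I mul0n E1; split=> // b; rewrite leqn0 muln_eq0 /=; lia.
    * move=> b s2 bc [s2L s2P s2S s2C] [u2r u2a]; split.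
        rewrite /= s2L u2r// u1r// sN ltr_nat /n; nia.
      have s2W : reg s2 rW = w%:R by rewrite u2r// u1r.
      apply: runs_weaken (runs_merge_block s2L s2W) _ _ => //.
      set lo := (b * (w + w))%N.
      have hi_n : (lo + w + w <= n)%N by rewrite /lo /n; nia.
      have hiE : (b.+1 * (w + w) = lo + w + w)%N by rewrite /lo; lia.
      have sorted_at b' : (b'.+1 * w <= n)%N -> (lo <= b' * w)%N ->
          sorted key_le (slice (cell s2 2) (b' * w) (b'.+1 * w)).
        move=> b'n lb'; rewrite (@eq_slice _ _ (cell s 2)); first exact: s_sorted.
        by move=> k /andP[kb _]; apply: s2C; exact: leq_trans kb.
      move=> s3 [s3L s3M s3C] _.
      have s3_low i j : (j <= lo)%N ->
          slice (cell s3 2) i j = slice (cell s2 2) i j.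
        by move=> jl; apply: eq_slice => k kj; apply: s3C; lia.
      have s3_high i j : (lo + w + w <= i)%N ->
          slice (cell s3 2) i j = slice (cell s2 2) i j.
        by move=> jl; apply: eq_slice => k kj; apply: s3C; lia.
      rewrite /I hiE; split=> //.
      (* Cut at the block: the outer parts agree, and merging permutes the middle. *)
      - apply: perm_trans s2P.
        rewrite !(@slice_cat _ _ 0 lo n); [|lia..].
        rewrite !(@slice_cat _ _ lo (lo + w + w) n); [|lia..].
        rewrite (s3_low 0%N lo)// (s3_high (lo + w + w)%N n)//.
        rewrite s3M perm_cat2l perm_cat2r.
        rewrite (@slice_cat _ _ lo (lo + w) (lo + w + w)); last lia.
        by rewrite perm_merge.
      - move=> b' b'n; have [b'b|bb'] := ltnP b' b.
          have h : (b'.+1 * (w + w) <= lo)%N by rewrite leq_mul2r b'b orbT.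
          by rewrite s3_low//; exact: s2S.
        have -> : b' = b by nia.
        (* The halves of the new block are the blocks of width w with indices 2b and 2b + 1. *)
        rewrite hiE -/lo s3M; apply: merge_sorted; first exact: key_le_total.
          have -> : (lo = b.*2 * w)%N by rewrite /lo; lia.
          have -> : (b.*2 * w + w = b.*2.+1 * w)%N by lia.
          apply: sorted_at; lia.
        have -> : (lo + w = b.*2.+1 * w)%N by rewrite /lo; lia.
        have -> : (b.*2.+1 * w + w = b.*2.+2 * w)%N by lia.
        apply: sorted_at; lia.
      - by move=> k hk; rewrite s3C ?s2C//; lia.
    * by move=> s2 [s2L _ _ _] [u2r _]; rewrite /= s2L u2r// u1r// sN ltr_nat ltnn.
  + rewrite /= /n; nia.
  + by move=> s2 [_ s2P s2S _] _; split.
- lia.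
Qed.

(** After j passes blocks of width 2^j are sorted. As the length is 2^m, every pass meets only full
    double blocks, and m passes of linear cost suffice. *)
Lemma runs_merge_sort s (m : nat) : reg s rN = (2 ^ m)%:R ->
  runs merge_sort s (300 * 2 ^ m * m + 20)%N (fun s' =>
    perm_eq (slice (cell s' 2) 0 (2 ^ m)) (slice (cell s 2) 0 (2 ^ m)) /\
    sorted key_le (slice (cell s' 2) 0 (2 ^ m))).
Proof.
move=> sN.
apply: (@runs_seq _ _ _ _ 2 (300 * 2 ^ m * m + 18) _ (fun s1 => reg s1 rW = 1)).
- exact: runs_loop_free.
- move=> s1 s1W [u1r u1a].
  have E1 : cell s1 2 = cell s 2 by rewrite /cell !u1a.
  pose I j s' := [/\ reg s' rW = (2 ^ j)%:R,
    perm_eq (slice (cell s' 2) 0 (2 ^ m)) (slice (cell s 2) 0 (2 ^ m)) &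
    blocks_sorted (cell s' 2) (2 ^ j) (2 ^ m)].
  apply: (@runs_weaken _ _ _ _ _ (I m)).
  + apply: (@runs_while _ _ _ _ (250 * 2 ^ m + 20)).
    * rewrite /I expn0 E1; split=> // b _.
      by rewrite muln1 slice_cons ?muln1// slice_nil.
    * move=> j s2 jm [s2W s2P s2S] [u2r u2a]; split.
        by rewrite /= s2W u2r// u1r// sN ltr_nat ltn_exp2l.
      have nE : (2 ^ m = 2 ^ (m - j.+1) * (2 ^ j + 2 ^ j))%N.
        by rewrite addnn -mul2n -expnS -expnD subnK.
      have s2N : reg s2 rN = (2 ^ (m - j.+1) * (2 ^ j + 2 ^ j))%:R.
        by rewrite -nE u2r// u1r.
      have w_gt0 : (0 < 2 ^ j)%N by rewrite expn_gt0.
      rewrite nE in s2S.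
      apply: (runs_seq (runs_merge_pass w_gt0 s2N s2W s2S) (n2 := 5)).
        move=> s3 [s3P s3S] [u3r _]; apply: runs_loop_free => //.
        split; first by rewrite /= u3r// s2W -natrD addnn expnS mul2n.
          by rewrite -nE in s3P; exact: perm_trans s2P.
        by move: s3S; rewrite -nE addnn -mul2n -expnS.
      by rewrite -nE; lia.
    * by move=> s2 [s2W _ _] [u2r _]; rewrite /= s2W u2r// u1r// sN ltxx.
  + have : (0 < 2 ^ m)%N by rewrite expn_gt0.
    rewrite /=; nia.
  + move=> s2 [_ s2P s2S] _; split=> //.
    by have := s2S 0%N; rewrite mul0n mul1n; apply.
- lia.
Qed.

End MergeSort.

(** * Operations on the quadratic form *)

Section Similarity.
Context {R : realType}.
Implicit Types (s : state R) (x d : nat -> R).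

Lemma ATB_similarity (T : nat) (r p : 'I_T -> R) s :
  unit_valued r -> loaded r p s ->
  ATB r p =
  (similarity T (arr s 0) (fun k => arr s 0 k - arr s 1 k) / T%:R ^+ 2)%:E.
Proof.
move=> r01 [_ sr sp]; rewrite ATBE//; congr EFin.
rewrite /similarity mulr_suml; apply: eq_bigr => t _.
by rewrite mulr_suml; apply: eq_bigr => u _; rewrite !sr !sp.
Qed.

Lemma eq_similarity n x d x' d' :
  (forall k, (k < n)%N -> x k = x' k) -> (forall k, (k < n)%N -> d k = d' k) ->
  similarity n x d = similarity n x' d'.
Proof.
move=> ex ed; apply: eq_bigr => i _; apply: eq_bigr => j _.
by rewrite !(ex _ (ltn_ord _)) !(ed _ (ltn_ord _)).
Qed.

(** As a double sum over the sequence of cells, the form is invariant under permutation, hence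
    preserved by sorting. *)
Lemma similarity_slice n s :
  similarity n (arr s 2) (arr s 3) =
  \sum_(a <- slice (cell s 2) 0 n) \sum_(b <- slice (cell s 2) 0 n)
    a.2 * b.2 * (1 - `|a.1 - b.1|).
Proof. by rewrite big_slice; apply: eq_bigr => i _; rewrite big_slice. Qed.

Lemma similarity_pad n N x d : (n <= N)%N ->
  (forall k, (n <= k < N)%N -> d k = 0) -> similarity N x d = similarity n x d.
Proof.
move=> nN d0.
have E (F : nat -> R) : (forall k, (n <= k < N)%N -> F k = 0) ->
    \sum_(i < N) F i = \sum_(i < n) F i.
  move=> F0; rewrite -!(big_mkord xpredT F) (big_cat_nat (n := n))//=.
  rewrite [X in _ + X]big_nat_cond [X in _ + X]big1 ?addr0// => k /andP[/F0].
  by [].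
rewrite /similarity (E (fun i => \sum_(j < N) d i * d j * (1 - `|x i - x j|))).
  apply: eq_bigr => i _.
  apply: (E (fun j => d i * d j * (1 - `|x i - x j|))) => k /d0 ->.
  by rewrite mulr0 mul0r.
by move=> k /d0 ->; apply: big1 => j _; rewrite !mul0r.
Qed.

(** The form is bilinear in the weights: totalling the weights of a bucket amounts to moving each
    point to the position of its bucket. Fact [E] is applied to one summation at a time. *)
Lemma similarity_bucket n N x d (b : nat -> nat) :
  (forall t, (t < n)%N -> (b t < N)%N) ->
  similarity N x (fun k => \sum_(t < n) if b t == k then d t else 0) =
  similarity n (x \o b) d.
Proof.
move=> bN.
have E (F : nat -> R) :
    \sum_(k < N) (\sum_(t < n) if b t == k then d t else 0) * F k =
    \sum_(t < n) d t * F (b t).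
  under eq_bigr do rewrite mulr_suml.
  rewrite exchange_big/=; apply: eq_bigr => t _.
  rewrite (bigD1 (Ordinal (bN t (ltn_ord t))))//= eqxx big1 ?addr0// => k kb.
  case: eqP => [bk|]; last by rewrite mul0r.
  by rewrite -val_eqE /= bk eqxx in kb.
transitivity (\sum_(i < N) (\sum_(t < n) if b t == i then d t else 0) *
    \sum_(u < n) d u * (1 - `|x i - x (b u)|)).
  apply: eq_bigr => i _; rewrite -(E (fun j => 1 - `|x i - x j|)) mulr_sumr.
  by apply: eq_bigr => j _; rewrite mulrA.
rewrite (E (fun i => \sum_(u < n) d u * (1 - `|x i - x (b u)|))).
apply: eq_bigr => t _; rewrite mulr_sumr.
by apply: eq_bigr => u _; rewrite mulrA.
Qed.

(** All displacements x - y lie in [0, eps], so two of them differ by at most eps: one-sided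
    rounding costs eps per pair, not 2 eps. *)
Lemma similarity_dist n x y d eps :
  (forall k, (k < n)%N -> `|d k| <= 1) ->
  (forall k, (k < n)%N -> 0 <= x k - y k <= eps) ->
  `|similarity n y d - similarity n x d| <= n%:R ^+ 2 * eps.
Proof.
move=> d1 xy; rewrite /similarity -sumrB.
have -> : n%:R ^+ 2 * eps = \sum_(i < n) \sum_(j < n) eps.
  by rewrite !sumr_const !card_ord -mulrnA -[RHS]mulr_natl natrM expr2.
apply: le_trans (ler_norm_sum _ _ _) _; apply: ler_sum => i _.
rewrite -sumrB.
apply: le_trans (ler_norm_sum _ _ _) _; apply: ler_sum => j _.
rewrite -mulrBr normrM normrM.
have di := d1 _ (ltn_ord i); have dj := d1 _ (ltn_ord j).
have xi := xy _ (ltn_ord i); have xj := xy _ (ltn_ord j).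
have dij : `|d i| * `|d j| <= 1 by rewrite mulr_ile1.
apply: le_trans (ler_piMl (normr_ge0 _) dij) _.
have -> : 1 - `|y i - y j| - (1 - `|x i - x j|) = `|x i - x j| - `|y i - y j|.
  by ring.
apply: le_trans (ler_dist_dist _ _) _.
by rewrite ler_norml; lra.
Qed.

End Similarity.

(** * The exact algorithm *)

Definition load_step : prog := (
  Pput 2 $rK (Eget 0 $rK) ;; Pput 3 $rK (Eget 0 $rK - Eget 1 $rK) ;;
  rK ::= $rK + Elit 1)%P.

Definition pad_step : prog := (
  Pput 2 $rK (Elit 0) ;; Pput 3 $rK (Elit 0) ;; rK ::= $rK + Elit 1)%P.

(* The padding entries have weight 0, so their positions are irrelevant. *)
Definition load_padded : prog := (
  rN ::= Elit 1 ;;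
  Pwhile ($rN < $rT) (rN ::= $rN + $rN) ;;
  rK ::= Elit 0 ;;
  Pwhile ($rK < $rT) load_step ;;
  Pwhile ($rK < $rN) pad_step)%P.

Definition exact_ATB : prog := (load_padded ;; merge_sort ;; sweep)%P.

Section Exact.
Context {R : realType}.
Implicit Types (s : state R).

Lemma runs_load_padded s (T : nat) : (0 < T)%N -> reg s rT = T%:R ->
  let m := up_log 2 T in
  runs load_padded s (100 * 2 ^ m + 100 * m + 100)%N (fun s' =>
    [/\ reg s' rN = (2 ^ m)%:R,
        forall k, (k < T)%N -> cell s' 2 k = (arr s 0 k, arr s 0 k - arr s 1 k) &
        forall k, (T <= k < 2 ^ m)%N -> cell s' 2 k = (0, 0)]).
Proof.
move=> T_gt0 sT m.
have Tm : (T <= 2 ^ m)%N by exact: up_logP.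
apply: (@runs_seq _ _ _ _ 2 (100 * 2 ^ m + 100 * m + 98) _
  (fun s1 => reg s1 rN = 1)); [exact: runs_loop_free| |lia].
move=> s1 s1N [u1r u1a].
apply: (@runs_seq _ _ _ _ (10 * m + 3) (100 * 2 ^ m + 20) _
  (fun s2 => reg s2 rN = (2 ^ m)%:R)).
- apply: (@runs_weaken _ _ _ _ _ (fun s2 => reg s2 rN = (2 ^ m)%:R)).
  + apply: (@runs_while _ _ _ _ 4 m (fun j s2 => reg s2 rN = (2 ^ j)%:R)).
    * by rewrite expn0.
    * move=> j s2 jm s2N [u2r _]; split.
        rewrite /= s2N u2r// u1r// sT ltr_nat.
        (* From j < m it follows that T > 1, and then minimality of m gives 2^j <= 2^(m-1) < T. *)
        have T_gt1 : (1 < T)%N.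
          have : (0 < up_log 2 T)%N by exact: leq_ltn_trans jm.
          by rewrite up_log_gt0.
        apply: leq_ltn_trans (up_log_gtn (p := 2) _ T_gt1) => //.
        by rewrite leq_exp2l//; rewrite -/m; lia.
      by apply: runs_loop_free => //=; rewrite s2N -natrD addnn expnS mul2n.
    * by move=> s2 s2N [u2r _]; rewrite /= s2N u2r// u1r// sT ltr_nat -leqNgt.
  + by rewrite /=; lia.
  + by [].
- move=> s2 s2N [u2r u2a].
  apply: (@runs_seq _ _ _ _ 2 (100 * 2 ^ m + 18) _ (fun s3 => reg s3 rK = 0));
    [exact: runs_loop_free| |lia].
  move=> s3 s3K [u3r u3a].
  have s3T : reg s3 rT = T%:R by rewrite u3r// u2r// u1r.
  have s3N : reg s3 rN = (2 ^ m)%:R by rewrite u3r.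
  have s30 : arr s3 0 = arr s 0 by rewrite u3a// u2a// u1a.
  have s31 : arr s3 1 = arr s 1 by rewrite u3a// u2a// u1a.
  pose I n s' := reg s' rK = n%:R /\ forall k, (k < n)%N ->
    cell s' 2 k = (arr s 0 k, arr s 0 k - arr s 1 k).
  pose J n s' := [/\ reg s' rK = (T + n)%:R, (forall k, (k < T)%N ->
    cell s' 2 k = (arr s 0 k, arr s 0 k - arr s 1 k)) &
    forall k, (T <= k < T + n)%N -> cell s' 2 k = (0, 0)].
  apply: (@runs_seq _ _ _ _ (40 * T + 3) (40 * (2 ^ m - T) + 3) _ (I T)); last lia.
  + apply: (@runs_weaken _ _ _ (T * (3 + 30) + 3) _ (I T)); [|lia|by []].
    apply: (@runs_while _ _ _ _ 30).
    * by [].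
    * move=> k s4 kT [s4K s4C] [u4r u4a]; split.
        by rewrite /= s4K u4r// s3T ltr_nat.
      apply: runs_loop_free => //; split; first by rewrite /= s4K natr1.
      move=> l lk; have := s4C l; rewrite /cell /= s4K natrK.
      rewrite (u4a 0%N)// (u4a 1%N)// s30 s31.
      by have [->//|lk' ->//] := eqVneq l k; rewrite ltn_neqAle lk'.
    * by move=> s4 [s4K _] [u4r _]; rewrite /= s4K u4r// s3T ltxx.
  + move=> s4 [s4K s4C] [u4r u4a].
    apply: (@runs_weaken _ _ _ _ _ (J (2 ^ m - T)%N)).
    * apply: (@runs_while _ _ _ _ 30).
      - by rewrite /J addn0; split=> // k; lia.
      - move=> k s5 kT [s5K s5C s5D] [u5r u5a]; split.
          by rewrite /= s5K u5r// u4r// s3N ltr_nat; lia.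
        apply: runs_loop_free => //; split; first by rewrite /= s5K natr1 addnS.
          move=> l lT; have := s5C l lT; rewrite /cell /= s5K natrK.
          by rewrite (ltn_eqF (ltn_addr k lT)).
        move=> l lTk; have := s5D l; rewrite /cell /= s5K natrK.
        by have [->//|lk' ->//] := eqVneq l (T + k)%N; lia.
      - by move=> s5 [s5K _ _] [u5r _]; rewrite /= s5K u5r// u4r// s3N subnKC// ltxx.
    * by rewrite /=; lia.
    * move=> s5 [_ s5C]; rewrite subnKC// => s5D [u5r _].
      by split=> //; rewrite u5r// u4r.
- lia.
Qed.

Lemma runs_exact_ATB s (T : nat) (r p : 'I_T -> R) :
  (0 < T)%N -> unit_valued r -> loaded r p s ->
  let m := up_log 2 T in
  runs exact_ATB s (150 * 2 ^ m + 300 * 2 ^ m * m + 100 * m + 200)%N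
    (fun s' => (reg s' 0)%:E = ATB r p).
Proof.
move=> T_gt0 r01 sL m; have [sT _ _] := sL.
have Tm : (T <= 2 ^ m)%N by exact: up_logP.
apply: (runs_seq (runs_load_padded T_gt0 sT)
  (n2 := (50 * 2 ^ m + 300 * 2 ^ m * m + 100)%N)); rewrite -/m; last lia.
move=> s1 [s1N s1C s1D] [u1r u1a].
apply: (runs_seq (runs_merge_sort s1N) (n2 := (50 * 2 ^ m + 50)%N)); last lia.
move=> s2 [s2P s2S] [u2r u2a].
have s2T : reg s2 rT = T%:R by rewrite u2r// u1r.
have s2N : reg s2 rN = (2 ^ m)%:R by rewrite u2r.
apply: runs_weaken (runs_sweep s2T s2N _) _ _ => //.
  move=> i j /andP[ij jm].
  have refl : reflexive (@key_le R) by move=> a; exact: lexx.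
  have := sorted_leq_nth (@key_le_trans R) refl (0, 0) s2S.
  move=> /(_ i j); rewrite !inE !size_slice subn0 => /(_ _ _ ij).
  by rewrite !nth_slice ?subn0 ?add0n//; [apply; lia|lia].
move=> s3 -> _; rewrite (ATB_similarity r01 sL); congr ((_ / _)%:E).
(* Permutation invariance undoes the sort; then the padding is dropped. *)
rewrite similarity_slice (perm_big _ s2P)/=.
under eq_bigr do rewrite (perm_big _ s2P)/=.
rewrite -similarity_slice (similarity_pad _ Tm).
  by apply: eq_similarity => k /s1C [].
by move=> k /s1D [].
Qed.

(** Rests on 2^m <= 2T and m ln 2 <= ln T + ln 2. The summand 1 in the bound covers T = 1, where T
    ln T vanishes. *)
Lemma exact_cost_bound (T m : nat) : (0 < T)%N -> m = up_log 2 T ->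
  (150 * 2 ^ m + 300 * 2 ^ m * m + 100 * m + 200)%N%:R <=
  3000 * ((ln 2)^-1 + 1) * (T%:R * ln T%:R + 1) :> R.
Proof.
move=> T_gt0 mE.
have ln2 : 0 < ln 2 :> R by rewrite ln_gt0// ltr1n.
have mT : (2 ^ m <= 2 * T)%N.
  have [T_gt1|] := ltnP 1 T; last by move=> T1; rewrite mE (_ : T = 1%N)//; lia.
  have m_gt0 : (0 < m)%N by rewrite mE up_log_gt0.
  by rewrite -(prednK m_gt0) expnS leq_mul2l /= ltnW// mE up_log_gtn.
have lnT : 0 <= ln T%:R :> R by rewrite ln_ge0// ler1n.
have m_ln : m%:R * ln 2 <= ln T%:R + ln 2 :> R.
  have T_pos : (0 : R) < T%:R by rewrite ltr0n.
  rewrite mulr_natl -lnXn// -lnM ?posrE// ler_ln ?posrE ?exprn_gt0 ?mulr_gt0//.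
  by rewrite -natrX mulrC -natrM ler_nat.
have T_ln : T%:R * ln 2 <= T%:R * ln T%:R + ln 2 :> R.
  have [T_gt1|] := ltnP 1 T; last first.
    by move=> T1; rewrite (_ : T = 1%N) ?ln1 ?mulr0 ?add0r ?mul1r//; lia.
  have : ln 2 <= ln T%:R :> R by rewrite ler_ln ?posrE ?ltr0n// ler_nat.
  by move=> /(ler_wpM2l (ler0n R T)) h; apply: le_trans h _; rewrite lerDl ltW.
(* Since 2^m <= 2T and T >= 1, the cost is at most 700 T m + 500 T. *)
apply: (@le_trans _ _ (1000 * (T * m + T)%N%:R)).
  by rewrite -natrM ler_nat; nia.
rewrite natrD natrM.
(* After multiplying by ln 2: T m ln 2 + T ln 2 <= T ln T + 2 T ln 2 <= 3 T ln T + 2 ln 2, whence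
   3000. *)
rewrite -(ler_pM2r ln2).
have -> : 3000 * ((ln 2)^-1 + 1) * (T%:R * ln T%:R + 1) * ln 2 =
    3000 * (1 + ln 2) * (T%:R * ln T%:R + 1) :> R.
  by field; rewrite gt_eqF.
have h := ler_wpM2l (ler0n R T) m_ln.
have h2 : 0 <= T%:R * ln T%:R :> R by rewrite mulr_ge0.
have h3 : 0 <= ln 2 * (T%:R * ln T%:R) :> R by rewrite mulr_ge0// ltW.
nra.
Qed.

End Exact.

(** * The approximation algorithm *)

(** Bucket k sits at k eps. The test is non-strict so that the value 1 has a bucket even when 1 /
    eps is an integer. *)
Definition bucket_init : prog := (
  rK ::= Elit 0 ;;
  Pwhile ($rK * $rE <= Elit 1)
    (Pput 2 $rK ($rK * $rE) ;; Pput 3 $rK (Elit 0) ;; rK ::= $rK + Elit 1) ;;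
  rN ::= $rK)%P.

(* The index [rI] is not an integer: array access truncates it. *)
Definition bucket_fill : prog := (
  rK ::= Elit 0 ;;
  Pwhile ($rK < $rT)
    (rI ::= Eget 0 $rK / $rE ;;
     Pput 3 $rI (Eget 3 $rI + (Eget 0 $rK - Eget 1 $rK)) ;;
     rK ::= $rK + Elit 1))%P.

Definition approx_ATB : prog := (bucket_init ;; bucket_fill ;; sweep)%P.

Section Approx.
Context {R : realType}.
Implicit Types (s : state R) (eps : R).

Lemma runs_bucket_init s eps : 0 < eps -> reg s rE = eps ->
  let N := (Num.truncn (1 / eps)).+1 in
  runs bucket_init s (50 * N + 20)%N (fun s' =>
    [/\ reg s' rN = N%:R, forall k, (k < N)%N -> arr s' 2 k = k%:R * eps &
        forall k, (k < N)%N -> arr s' 3 k = 0]).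
Proof.
move=> eps_gt0 sE N.
have inv_ge0 : 0 <= 1 / eps by rewrite divr_ge0// ltW.
apply: (@runs_seq _ _ _ _ 2 (50 * N + 18) _ (fun s1 => reg s1 rK = 0));
  [exact: runs_loop_free| |lia].
move=> s1 s1K [u1r _].
pose I n s' := [/\ reg s' rK = n%:R,
  forall k, (k < n)%N -> arr s' 2 k = k%:R * eps &
  forall k, (k < n)%N -> arr s' 3 k = 0].
apply: (@runs_seq _ _ _ _ (40 * N + 5) 2 _ (I N)); last lia.
- apply: (@runs_weaken _ _ _ (N * (5 + 30) + 5) _ (I N)); [|lia|by []].
  apply: (@runs_while _ _ _ _ 30).
  + by [].
  + move=> k s2 kN [s2K s2A s2B] [u2r _]; split.
      by rewrite /= s2K u2r// u1r// sE -ler_pdivlMr// -truncn_ge_nat.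
    apply: runs_loop_free => //.
    rewrite /I /= s2K natrK natr1 (u2r rE)// u1r// sE; split=> // l.
      rewrite ltnS leq_eqVlt; case: eqVneq => [->//|_] /=; exact: s2A.
    rewrite ltnS leq_eqVlt; case: eqVneq => [//|_] /=; exact: s2B.
  + move=> s2 [s2K _ _] [u2r _]; rewrite /= s2K u2r// u1r// sE.
    by rewrite -ler_pdivlMr// -truncn_ge_nat// ltnn.
- by move=> s2 [s2K s2A s2B] _; apply: runs_loop_free.
Qed.

Lemma runs_bucket_fill s (T N : nat) eps :
  reg s rT = T%:R -> reg s rE = eps ->
  (forall k, (k < N)%N -> arr s 3 k = 0) ->
  runs bucket_fill s (50 * T + 20)%N (fun s' => forall k, (k < N)%N ->
    arr s' 3 k = \sum_(t < T) if Num.truncn (arr s 0 t / eps) == k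
                              then arr s 0 t - arr s 1 t else 0).
Proof.
move=> sT sE s3.
apply: (@runs_seq _ _ _ _ 2 (50 * T + 18) _ (fun s1 => reg s1 rK = 0));
  [exact: runs_loop_free| |lia].
move=> s1 s1K [u1r u1a].
pose I n s' := reg s' rK = n%:R /\ forall k, (k < N)%N ->
    arr s' 3 k = \sum_(t < n) if Num.truncn (arr s 0 t / eps) == k
                              then arr s 0 t - arr s 1 t else 0.
apply: (@runs_weaken _ _ _ (T * (3 + 40) + 3) _ (I T)); [|lia|by move=> s2 []].
apply: (@runs_while _ _ _ _ 40).
- by split=> // k kN; rewrite big_ord0 u1a// s3.
- move=> n s2 nT [s2K s2B] [u2r u2a]; split.
    by rewrite /= s2K u2r// u1r// sT ltr_nat.
  apply: runs_loop_free => //; split; first by rewrite /= s2K natr1.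
  move=> k kN; rewrite big_ord_recr /= -s2B// s2K natrK (u2r rE)// u1r// sE.
  rewrite !(u2a 0%N, u2a 1%N)// !u1a// eq_sym.
  by case: eqP => [->//|_]; rewrite addr0.
- by move=> s2 [s2K _] [u2r _]; rewrite /= s2K u2r// u1r// sT ltxx.
Qed.

Lemma runs_approx_ATB s (T : nat) (r p : 'I_T -> R) eps :
  (0 < T)%N -> unit_valued r -> unit_valued p -> 0 < eps ->
  loaded r p s -> reg s rE = eps ->
  runs approx_ATB s (50 * T + 100 * (Num.truncn (1 / eps)).+1 + 100)%N
    (fun s' => (`| (reg s' 0)%:E - ATB r p | <= eps%:E)%E).
Proof.
move=> T_gt0 r01 p01 eps_gt0 sL sE; have [sT sr sp] := sL.
set N := (Num.truncn (1 / eps)).+1.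
apply: (runs_seq (runs_bucket_init eps_gt0 sE) (n2 := (50 * T + 50 * N + 80)%N));
  rewrite -/N; last lia.
move=> s1 [s1N s1A s1B] [u1r u1a].
have s1T : reg s1 rT = T%:R by rewrite u1r.
have s1E : reg s1 rE = eps by rewrite u1r.
apply: (runs_seq (runs_bucket_fill s1T s1E s1B) (n2 := (50 * N + 50)%N));
  last lia.
rewrite !u1a// => s2 s2B [u2r u2a].
have s2T : reg s2 rT = T%:R by rewrite u2r.
have s2N : reg s2 rN = N%:R by rewrite u2r.
apply: runs_weaken (runs_sweep s2T s2N _) _ _ => //.
  (* Bucket positions k eps increase with k, so the sweep needs no sorting. *)
  move=> i j /andP[ij jN]; rewrite !u2a// !s1A//; last exact: leq_ltn_trans jN.
  by rewrite ler_pM2r// ler_nat.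
move=> s3 -> _; rewrite (ATB_similarity r01 sL).
pose b k := Num.truncn (arr s 0 k / eps).
pose d k := arr s 0 k - arr s 1 k.
have x01 k : (k < T)%N -> 0 <= arr s 0 k <= 1.
  by move=> kT; rewrite (sr (Ordinal kT)).
have y01 k : (k < T)%N -> 0 <= arr s 1 k <= 1.
  by move=> kT; rewrite (sp (Ordinal kT)).
have bN k : (k < T)%N -> (b k < N)%N.
  move=> /x01/andP[x0 x1]; rewrite ltnS.
  by apply: le_truncn; rewrite ler_pM2r ?invr_gt0.
(* The sweep over the buckets evaluates the form at the rounded positions with the original
   weights. *)
have -> : similarity N (arr s2 2) (arr s2 3) =
    similarity T ((fun k => k%:R * eps) \o b) d.
  rewrite -(similarity_bucket _ _ bN); apply: eq_similarity => // k kN.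
  by rewrite u2a// s1A.
have T2 : 0 < T%:R ^+ 2 :> R by rewrite exprn_gt0// ltr0n.
rewrite -EFinB abse_EFin lee_fin -mulrBl normrM.
rewrite [X in _ * X]gtr0_norm ?invr_gt0//.
rewrite ler_pdivrMr// [leRHS]mulrC.
apply: similarity_dist => k kT.
  by have := x01 k kT; have := y01 k kT; rewrite ler_norml /d; lra.
have /andP[x0 x1] := x01 k kT.
(* From b <= r / eps < b + 1, rounding down moves r by at most eps. *)
have /truncn_itv/andP[] : 0 <= arr s 0 k / eps by rewrite divr_ge0// ltW.
rewrite ler_pdivlMr// ltr_pdivrMr// -natr1 -/(b k) /=.
lra.
Qed.

(** Truncation gives at most 1 / eps, and T >= 1 absorbs the constants: the cost is at most 250 T +
    100 / eps. *)
Lemma approx_cost_bound (T : nat) eps : (0 < T)%N -> 0 < eps ->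
  (50 * T + 100 * (Num.truncn (1 / eps)).+1 + 100)%N%:R <=
  300 * (T%:R + 1 / eps) :> R.
Proof.
move=> T_gt0 eps_gt0.
have inv_ge0 : 0 <= 1 / eps by rewrite divr_ge0// ltW.
have /andP[le_inv _] := truncn_itv inv_ge0.
have T1 : 1 <= T%:R :> R by rewrite ler1n.
rewrite !natrD !natrM -natr1; lra.
Qed.

End Approx.

Theorem theorem4p12 (R : realType) :
  (exists (c : prog) (C : R),
     forall (T : nat) (r p : 'I_T -> R) (s : state R),
       (0 < T)%N -> unit_valued r -> unit_valued p -> loaded r p s ->
       exists (s' : state R) (n : nat),
         [/\ exec c s s' n,
             (reg s' 0)%:E = ATB r p &
             n%:R <= C * (T%:R * ln T%:R + 1)])
  /\
  (exists (c : prog) (C : R),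
     forall (T : nat) (r p : 'I_T -> R) (eps : R) (s : state R),
       (0 < T)%N -> unit_valued r -> unit_valued p -> 0 < eps ->
       loaded r p s -> reg s 1 = eps ->
       exists (s' : state R) (n : nat),
         [/\ exec c s s' n,
             (`| (reg s' 0)%:E - ATB r p | <= eps%:E)%E &
             n%:R <= C * (T%:R + 1 / eps)]).
Proof.
split.
- exists exact_ATB, (3000 * ((ln 2)^-1 + 1)) => T r p s T_gt0 r01 _ sL.
  have [s' [n [e ln_n out]]] := runs_exact_ATB T_gt0 r01 sL.
  exists s', n; split=> //; apply: le_trans (exact_cost_bound T_gt0 erefl).
  by rewrite ler_nat.
- exists approx_ATB, 300 => T r p eps s T_gt0 r01 p01 eps_gt0 sL sE.
  have [s' [n [e le_n out]]] := runs_approx_ATB T_gt0 r01 p01 eps_gt0 sL sE.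
  exists s', n; split=> //; apply: le_trans (approx_cost_bound T_gt0 eps_gt0).
  by rewrite ler_nat.
Qed.
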